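(* There is an absolute constant $c>0$ such that the following holds. Call an input array $C$ of $N$ $n$-bit integers good if $\mathrm{wkt}_C(\vec e_{\mathsf o})/\mathrm{wkt}_C(\vec e_{\mathsf a})\ge c\,\frac{2^{n/6}}{N\log N}$, and bad otherwise; let $g$ and $b$ be the numbers of good and bad inputs. Then $g/b=\Omega\!\left(\frac{2^{n/3}}{N^2}\right)$; in particular, as $n\to\infty$ (with $N$ fixed), $g/b\to\infty$.
   Context: An input is an array $C[1..N]$ of $n$-bit integers (in $\{0,\dots,2^n-1\}$), bits indexed $1$ (least significant) to $n$ (most significant); entries are assumed distinct. An energy vector $\vec e=(e_1,\dots,e_n)$ assigns energy $e_j\ge0$ to bit $j$. An inexact comparison of two items $u,v$ with energy vector $\vec e$ reads each bit $j$ of $u$ and of $v$ independently, flipped with probability $2^{-e_j}$, and orders $u,v$ according to the read values; each comparison uses fresh independent randomness. The array is sorted by randomized quicksort (uniformly random pivot, partition by inexact comparisons with the pivot, recursion). $Q(u,v,\vec e)$ is the event that in the quicksort output $u,v$ are in the wrong relative order, and $\mathrm{wkt}_C(\vec e)=\sum_{1\le a<b\le N}|C[a]-C[b]|\cdot\Pr[Q(C[a],C[b],\vec e)]$ (probability over pivots and comparison errors). $\vec e_{\mathsf a}=(1,2,\dots,n)$ and $\vec e_{\mathsf o}=(\frac{n+1}{2},\dots,\frac{n+1}{2})$. *)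

(* Defs.v *)
From mathcomp Require Import all_boot all_order all_algebra.
From mathcomp Require Import reals exp.
Set Implicit Arguments. Unset Strict Implicit. Unset Printing Implicit Defensive.
Import Order.TTheory GRing.Theory Num.Theory.
Local Open Scope ring_scope.

Section Quicksort.
Variable R : realType.

(* Energy vectors: e : nat -> R, used on bit indices 1..n (1 = least significant). *)
Definition e_a : nat -> R := fun j => j%:R.
Definition e_o (n : nat) : nat -> R := fun _ => (n.+1)%:R / 2.

(* probability that bit j (1-indexed) is flipped when read *)
Definition flipprob (e : nat -> R) (j : nat) : R := powR 2 (- e j).

Definition bit (x j : nat) : bool := odd (x %/ 2 ^ j).

Definition readprob (n : nat) (e : nat -> R) (x x' : nat) : R :=
  \prod_(j < n) (if bit x j == bit x' j then 1 - flipprob e j.+1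
                 else flipprob e j.+1).

(* probability that an inexact comparison of x with p declares x smaller than p
   (read values compared; a tie of read values is broken by a fair coin) *)
Definition ltprob (n : nat) (e : nat -> R) (x p : nat) : R :=
  \sum_(x' < 2 ^ n) \sum_(p' < 2 ^ n)
     readprob n e x x' * readprob n e p p' *
     (if (x' < p')%N then 1 else if x' == p' :> nat then 2^-1 else 0).

Fixpoint masks (k : nat) : seq (seq bool) :=
  if k is k'.+1 then [seq b :: m | b <- [:: true; false], m <- masks k']
  else [:: [::]].

(* probability of a given left/right outcome (true = sent to the left part,
   i.e. declared smaller than the pivot) of the partition comparisons *)
Definition maskw (lt : nat -> R) (os : seq nat) (m : seq bool) : R :=
  \prod_(i < size os) (if nth false m i then lt (nth 0%N os i)
                       else 1 - lt (nth 0%N os i)).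

(* before cmp fuel s u v : probability that randomized quicksort of the list s
   (distinct entries), using the random comparison "x declared smaller than
   pivot p with probability cmp x p", outputs u before v.  Called with
   fuel = size s.  The pivot is uniform among the entries of s; each comparison
   with the pivot uses independent randomness. *)
Fixpoint before (cmp : nat -> nat -> R) (fuel : nat) (s : seq nat) (u v : nat)
  : R :=
  match fuel with
  | 0 => 0
  | f.+1 =>
    (size s)%:R^-1 *
    \sum_(p <- s)
      \sum_(m <- masks (size (rem p s)))
        maskw (fun x => cmp x p) (rem p s) m *
        (let L := mask m (rem p s) in
         let Rt := mask (map negb m) (rem p s) in
         let pos := fun x => if x \in L then 0%N else if x == p then 1%N else 2%N in
         if (pos u < pos v)%N then 1
         else if (pos v < pos u)%N then 0
         else if u \in L then before cmp f L u v else before cmp f Rt u v)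
  end.

Definition PrQ (n : nat) (e : nat -> R) (s : seq nat) (u v : nat) : R :=
  if (u < v)%N then before (ltprob n e) (size s) s v u
  else before (ltprob n e) (size s) s u v.

Definition wkt (n : nat) (e : nat -> R) (C : seq nat) : R :=
  \sum_(a < size C) \sum_(b < size C | (a < b)%N)
     `|(nth 0%N C a)%:R - (nth 0%N C b)%:R| * PrQ n e C (nth 0%N C a) (nth 0%N C b).

Definition arr_seq (n N : nat) (C : {ffun 'I_N -> 'I_(2 ^ n)}) : seq nat :=
  [seq val (C i) | i <- enum 'I_N].

Definition good (c : R) (n N : nat) (C : {ffun 'I_N -> 'I_(2 ^ n)}) : bool :=
  c * powR 2 (n%:R / 6) / (N%:R * ln N%:R)
    <= wkt n (e_o n) (arr_seq C) / wkt n e_a (arr_seq C).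

Definition ngood (c : R) (n N : nat) : nat :=
  #|[set C : {ffun 'I_N -> 'I_(2 ^ n)} | injectiveb C && good c C]|.
Definition nbad (c : R) (n N : nat) : nat :=
  #|[set C : {ffun 'I_N -> 'I_(2 ^ n)} | injectiveb C && ~~ good c C]|.

End Quicksort.

(* Main.v *)
Require Import Defs.
From mathcomp Require Import all_boot all_order all_algebra.
From mathcomp Require Import perm.
From mathcomp Require Import reals exp.
From mathcomp Require Import ring lra zify.
Set Implicit Arguments. Unset Strict Implicit. Unset Printing Implicit Defensive.
Import Order.TTheory GRing.Theory Num.Theory.
Local Open Scope ring_scope.

(** Upper bound for [e_a].  A comparison of values at distance [d] errs with
    probability at most [4 / d].  A pivot that separates [u] and [v] in the wrong
    order errs over a distance of at least [|u - v| / 2], so it does so with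
    probability at most [8 / |u - v|].  Whatever the comparison probabilities,
    the expected size of the part receiving [u] is at most [3 / 4] of the list,
    so [u] and [v] stay together for [O(ln N)] levels.  Hence
    [wkt e_a = O(N^2 ln N)] on every input.

    Lower bound for [e_o], with flip probability [q = 2^(-(n+1)/2)].  The pair is
    compared directly at the first level with probability at least [1 / N], and
    if [u], [v] have the same top bit that comparison errs with probability at
    least [q / 2].  When [N >= 3] a positive fraction of the pairs agree on the
    top bit, so an input is good as soon as few pairs are at distance less than
    [w ~ 2^(2n/3)].  When [N = 2] and the top bits differ, one compares the lower
    bits: in the reversed order they give an error probability of order [q] for
    [e_o]; in the same order the error probabilities are at least [q^2] for [e_o]
    and [O(2^(-n) / d')] for [e_a], with [d'] the distance of the lower parts.

    In both cases a bad input has a positive fraction of close pairs, and a given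
    pair of entries is close for a fraction [O(w / 2^n) = O(2^(-n/3))] of the
    inputs; double counting gives the same bound for the fraction of bad
    inputs. *)

(** * Expectation over the outcome of a partition *)

Section Partition.
Variable R : realType.
Implicit Types (lt : nat -> R) (os : seq nat).

Lemma sumr_const_seq (I : Type) (s : seq I) (c : R) :
  \sum_(x <- s) c = (size s)%:R * c.
Proof. by rewrite big_const_seq count_predT iter_addr_0 mulr_natl. Qed.

Lemma size_filter_sum (I : Type) (s : seq I) (P : pred I) :
  (size [seq x <- s | P x])%:R = \sum_(x <- s) (P x)%:R :> R.
Proof.
rewrite size_filter -sum1_count big_mkcond natr_sum.
by apply: eq_bigr => x _; case: (P x).
Qed.

Lemma ler_sum_seq (I : eqType) (s : seq I) (F G : I -> R) :
  (forall x, x \in s -> F x <= G x) -> \sum_(x <- s) F x <= \sum_(x <- s) G x.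
Proof. by move=> FG; rewrite big_seq [leRHS]big_seq; apply: ler_sum. Qed.

Definition Emask lt os (F : seq bool -> R) : R :=
  \sum_(m <- masks (size os)) maskw lt os m * F m.

Lemma Emask_nil lt F : Emask lt [::] F = F [::].
Proof. by rewrite /Emask /= big_seq1 /maskw big_ord0 mul1r. Qed.

Lemma Emask_cons lt x os F :
  Emask lt (x :: os) F = lt x * Emask lt os (fun m => F (true :: m)) +
                         (1 - lt x) * Emask lt os (fun m => F (false :: m)).
Proof.
rewrite /Emask /= big_cat cats0 /= !big_map !mulr_sumr.
by congr (_ + _); apply: eq_bigr => m _; rewrite /maskw big_ord_recl /= mulrA.
Qed.

Lemma size_masks k m : m \in masks k -> size m = k.
Proof.
elim: k m => [|k IH] m; first by rewrite inE => /eqP->.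
by rewrite /= mem_cat cats0 => /orP[] /mapP[m' /IH <- ->].
Qed.

Lemma eq_Emask lt os F G :
  (forall m, size m = size os -> F m = G m) -> Emask lt os F = Emask lt os G.
Proof.
by move=> FG; apply: eq_big_seq => m /size_masks /FG ->.
Qed.
Arguments eq_Emask {lt os F} G _.

Lemma Emask_const lt os (c : R) : Emask lt os (fun=> c) = c.
Proof.
elim: os => [|x os IH]; first by rewrite Emask_nil.
by rewrite Emask_cons IH; ring.
Qed.

Lemma EmaskD lt os F G :
  Emask lt os (fun m => F m + G m) = Emask lt os F + Emask lt os G.
Proof. by rewrite -big_split; apply: eq_bigr => m _; rewrite mulrDr. Qed.

Lemma EmaskZ lt os (c : R) F :
  Emask lt os (fun m => c * F m) = c * Emask lt os F.
Proof. by rewrite mulr_sumr; apply: eq_bigr => m _; rewrite mulrCA. Qed.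

Lemma Emask_sum lt os (r : seq nat) (F : nat -> seq bool -> R) :
  Emask lt os (fun m => \sum_(x <- r) F x m) = \sum_(x <- r) Emask lt os (F x).
Proof.
rewrite exchange_big; apply: eq_bigr => m _ /=; by rewrite mulr_sumr.
Qed.

Lemma Emask_le lt os F G : (forall x, 0 <= lt x <= 1) ->
  (forall m, size m = size os -> F m <= G m) -> Emask lt os F <= Emask lt os G.
Proof.
move=> lt01 FG; apply: ler_sum_seq => m /size_masks /FG FGm.
apply: ler_wpM2l => //; apply: prodr_ge0 => i _.
by have := lt01 (nth 0%N os i); case: ifP => _; lra.
Qed.

Lemma Emask_mem1 lt os x : uniq os -> x \in os ->
  Emask lt os (fun m => (x \in mask m os)%:R) = lt x.
Proof.
elim: os => [|y os IH] //= /andP[yos uos]; rewrite inE Emask_cons.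
have [-> _ | nxy /= xos] := eqVneq x y.
  rewrite (eq_Emask (fun=> 1)); last by move=> m _; rewrite /= inE eqxx.
  rewrite Emask_const (eq_Emask (fun=> 0)) ?Emask_const; first by ring.
  move=> m _; rewrite /=.
  by rewrite (_ : (y \in _) = false) //; apply: (contraNF _ yos) => /mem_mask.
rewrite (eq_Emask (fun m => (x \in mask m os)%:R)); last first.
  by move=> m _; rewrite /= inE (negPf nxy).
by rewrite IH //; ring.
Qed.

(** Without duplicates, membership in the left part is decided by the entry's own comparison, and
    the comparisons of distinct entries are independent. *)
Lemma Emask_mem2 lt os x y : uniq os -> x \in os -> y \in os -> x != y ->
  Emask lt os (fun m => (x \in mask m os)%:R * (y \in mask m os)%:R) =
  lt x * lt y.
Proof.
elim: os => [|z os IH] //= /andP[zos uos] xs ys nxy; rewrite Emask_cons.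
have zm m : (z \in mask m os) = false by apply: (contraNF _ zos) => /mem_mask.
have [xz | nxz] := eqVneq x z.
  have nyz : y != z by rewrite -xz eq_sym.
  move: ys; rewrite inE (negPf nyz) /= => yos.
  rewrite (eq_Emask (fun m => (y \in mask m os)%:R)); last first.
    by move=> m _; rewrite /= !inE xz eqxx (negPf nyz) mul1r.
  rewrite Emask_mem1 // (eq_Emask (fun=> 0)) ?Emask_const ?xz; first by ring.
  by move=> m _; rewrite /= zm mul0r.
move: xs; rewrite inE (negPf nxz) /= => xos.
have [yz | nyz] := eqVneq y z.
  rewrite (eq_Emask (fun m => (x \in mask m os)%:R)); last first.
    by move=> m _; rewrite /= !inE yz eqxx (negPf nxz) mulr1.
  rewrite Emask_mem1 // (eq_Emask (fun=> 0)) ?Emask_const ?yz; first by ring.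
  by move=> m _; rewrite /= zm mulr0.
move: ys; rewrite inE (negPf nyz) /= => yos.
rewrite (eq_Emask (fun m => (x \in mask m os)%:R * (y \in mask m os)%:R)).
  by rewrite IH //; ring.
by move=> m _; rewrite /= !inE (negPf nxz) (negPf nyz).
Qed.

Lemma Emask_same_side lt os x y : uniq os -> x \in os -> y \in os -> x != y ->
  Emask lt os (fun m => ((x \in mask m os) == (y \in mask m os))%:R) =
  lt x * lt y + (1 - lt x) * (1 - lt y).
Proof.
move=> uos xos yos nxy.
rewrite (eq_Emask (fun m =>
  (2 * ((x \in mask m os)%:R * (y \in mask m os)%:R) + - 1 * (x \in mask m os)%:R)
  + (- 1 * (y \in mask m os)%:R + 1))); last first.
  by move=> m _; case: (x \in _); case: (y \in _); rewrite /=; ring.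
rewrite !EmaskD !EmaskZ Emask_const Emask_mem2 // !Emask_mem1 //; ring.
Qed.

(** As a filter, the right part has a size that is a sum of indicators. *)
Lemma mask_negb m os : uniq os -> size m = size os ->
  mask (map negb m) os = [seq x <- os | x \notin mask m os].
Proof.
elim: os m => [|y os IH] [|b m] //= /andP[yos uos] [sm].
have ym : (y \in mask m os) = false by apply: (contraNF _ yos) => /mem_mask.
rewrite IH //; case: b => /=; rewrite ?inE ?eqxx ?ym //=.
by apply: eq_in_filter => x xos; rewrite inE; case: eqP xos yos => [->->|].
Qed.

Lemma mask_filter_mem m os : uniq os ->
  mask m os = [seq x <- os | x \in mask m os].
Proof. by move=> uos; apply/(subseq_uniqP uos)/mask_subseq. Qed.

End Partition.
Arguments eq_Emask {R lt os F} G _.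

(** * Quicksort with arbitrary comparison probabilities *)

Section QuicksortBounds.
Variable R : realType.
Variable cmp : nat -> nat -> R.
Hypothesis cmp01 : forall x y, 0 <= cmp x y <= 1.

(** One level of [before] at a fixed pivot and outcome, the recursive call being abstracted into
    [B]; it stays convertible to the original, so [beforeS] holds by computation. *)
Definition split_value (B : seq nat -> R) p os u v (m : seq bool) : R :=
  let L := mask m os in
  let Rt := mask (map negb m) os in
  let pos := fun x => if x \in L then 0%N else if x == p then 1%N else 2%N in
  if (pos u < pos v)%N then 1
  else if (pos v < pos u)%N then 0
  else if u \in L then B L else B Rt.

Lemma beforeS f s u v :
  before cmp f.+1 s u v = (size s)%:R^-1 *
    \sum_(p <- s) Emask (cmp^~ p) (rem p s)
      (split_value (fun t => before cmp f t u v) p (rem p s) u v).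
Proof. by []. Qed.

Lemma before_ge0 f s u v : 0 <= before cmp f s u v.
Proof.
elim: f s => [|f IH] s; first by [].
rewrite beforeS mulr_ge0 ?invr_ge0 ?ler0n // sumr_ge0 // => p _.
rewrite -[leLHS](Emask_const (cmp^~ p) (rem p s)).
apply: Emask_le => // m _; rewrite /split_value.
by do 3?case: ifP => _ //; rewrite ?ler01.
Qed.

(** It suffices that [v] is the first pivot and that [u] is sent to its left. *)
Lemma before_ge_cmp s u v : uniq s -> u \in s -> v \in s -> u != v ->
  (size s)%:R^-1 * cmp u v <= before cmp (size s) s u v.
Proof.
move=> us uins vins nuv.
have : (0 < size s)%N by case: s uins {us vins}.
(* Only the fuel and its positivity are generalised; the factor [(size s)%:R^-1] is kept. *)
move: {1 3}(size s) => k; case: k => // k _.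
rewrite beforeS; apply: ler_wpM2l; first by rewrite invr_ge0 ler0n.
rewrite (bigD1_seq v) //= -[leLHS]addr0; apply: lerD.
  rewrite -(@Emask_mem1 _ (cmp^~ v) (rem v s) u) ?rem_uniq //; last first.
    by rewrite mem_rem_uniq // inE nuv.
  apply: Emask_le => // m _; rewrite /split_value.
  have -> : (v \in mask m (rem v s)) = false.
    by apply/negP => /mem_mask; rewrite mem_rem_uniq // inE eqxx.
  rewrite eqxx; case: (u \in _) => /=; first by [].
  by rewrite (negPf nuv).
apply: sumr_ge0 => p _.
rewrite -[leLHS](Emask_const (cmp^~ p) (rem p s)).
apply: Emask_le => // m _; rewrite /split_value.
by do 3?case: ifP => _ //; rewrite ?ler01 ?before_ge0.
Qed.

Hypothesis cmpC : forall x y : nat, x != y -> cmp x y + cmp y x = 1.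

(* The size of the part of the partition at [p] that receives [u]. *)
Definition part_size (p : nat) (os : seq nat) (u : nat) (m : seq bool) : R :=
  if p == u then 1
  else \sum_(x <- os) ((x \in mask m os) == (u \in mask m os))%:R.

(** The guard [x != p] lets the sum range over [rem u s] whatever [p] is, so that the sum over all
    pivots can be symmetrised in [x] and [p]. *)
Lemma Emask_part_size s p u : uniq s -> p \in s -> u \in s ->
  Emask (cmp^~ p) (rem p s) (part_size p (rem p s) u) =
  1 + (p != u)%:R * \sum_(x <- rem u s) (x != p)%:R *
      (cmp x p * cmp u p + (1 - cmp x p) * (1 - cmp u p)).
Proof.
move=> us ps uins; rewrite /part_size.
have [->|npu] := eqVneq p u; first by rewrite Emask_const mul0r addr0.
have uos : uniq (rem p s) by rewrite rem_uniq.
have uin : u \in rem p s by rewrite mem_rem_uniq // inE eq_sym npu.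
rewrite Emask_sum (bigD1_seq u) //=; congr (_ + _).
  by rewrite (eq_Emask (fun=> 1)) ?Emask_const // => m _; rewrite eqxx.
rewrite mul1r [in RHS](big_rem p) /=; last by rewrite mem_rem_uniq // inE npu.
rewrite eqxx mul0r add0r.
have -> : \sum_(y <- rem p (rem u s)) (y != p)%:R *
      (cmp y p * cmp u p + (1 - cmp y p) * (1 - cmp u p)) =
  \sum_(y <- rem p (rem u s)) (cmp y p * cmp u p + (1 - cmp y p) * (1 - cmp u p)).
  apply: eq_big_seq => y; rewrite mem_rem_uniq ?rem_uniq // inE => /andP[-> _].
  by rewrite mul1r.
have -> : rem p (rem u s) = [seq x <- rem p s | x != u].
  rewrite rem_filter ?rem_uniq // !(rem_filter _ us) -!filter_predI.
  by apply: eq_filter => x /=; rewrite andbC.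
rewrite big_filter [LHS]big_seq_cond [RHS]big_seq_cond; apply: eq_bigr => x /andP[xs nxu].
by rewrite Emask_same_side.
Qed.

(* For a pair [x, y] different from [u], the two events "[x] stays with [u]
   when [y] is the pivot" and vice versa have total probability at most
   [1 + a_x (1 - a_y) + a_y (1 - a_x)] with [a_x] the probability of [u < x]. *)
Lemma sum_part_size s u : uniq s -> u \in s -> (1 < size s)%N ->
  \sum_(p <- s) Emask (cmp^~ p) (rem p s) (part_size p (rem p s) u)
    <= 3 / 4 * (size s)%:R ^+ 2.
Proof.
move=> us uins s1.
pose h x p := (x != p)%:R * (cmp x p * cmp u p + (1 - cmp x p) * (1 - cmp u p)).
have -> : \sum_(p <- s) Emask (cmp^~ p) (rem p s) (part_size p (rem p s) u) =
    (size s)%:R + \sum_(p <- rem u s) \sum_(x <- rem u s) h x p.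
  rewrite (eq_big_seq (fun p => 1 + (p != u)%:R * \sum_(x <- rem u s) h x p)).
    rewrite big_split /= sumr_const_seq mulr1; congr (_ + _).
    rewrite (big_rem u) //= eqxx mul0r add0r.
    apply: eq_big_seq => p; rewrite mem_rem_uniq // inE => /andP[-> _].
    by rewrite mul1r.
  by move=> p ps; rewrite Emask_part_size.
have rs : size (rem u s) = (size s).-1 by rewrite size_rem.
have ur : uniq (rem u s) by rewrite rem_uniq.
set r := rem u s in rs ur *.
have ks : (size s)%:R = (size r)%:R + 1 :> R.
  by rewrite rs natr1 prednK //; lia.
have m1 : 1 <= (size r)%:R :> R by rewrite ler1n rs; lia.
set S : R := \sum_(x <- r) cmp u x.
have hS : \sum_(p <- r) \sum_(x <- r) (h x p + h p x) <=
   \sum_(p <- r) \sum_(x <- r) ((x != p)%:R + (cmp u x * (1 - cmp u p) + cmp u p * (1 - cmp u x))).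
  apply: ler_sum => p _; apply: ler_sum => x _; rewrite /h [p == x]eq_sym.
  have [-> |nxp] := eqVneq x p.
    rewrite !mul0r !add0r; have := cmp01 u p; nra.
  have := cmpC nxp; have := cmp01 u x; have := cmp01 u p; have := cmp01 x p.
  rewrite /= !mul1r => /andP[t0 t1] /andP[a0 a1] /andP[b0 b1] ht.
  have -> : cmp p x = 1 - cmp x p by lra.
  move: (cmp x p) (cmp u p) (cmp u x) t0 t1 a0 a1 b0 b1 {ht} => t a b t0 t1 a0 a1 b0 b1.
  (* The right side exceeds the left by exactly twice the sum of these two products. *)
  have e0 : 0 <= (1 - t) * (a * (1 - b)) by rewrite !mulr_ge0 //; lra.
  have e1 : 0 <= t * (b * (1 - a)) by rewrite !mulr_ge0 //; lra.
  lra.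
have dbl : \sum_(p <- r) \sum_(x <- r) (h x p + h p x) =
    2 * \sum_(p <- r) \sum_(x <- r) h x p.
  under eq_bigr do rewrite big_split.
  rewrite big_split /= [X in _ + X]exchange_big /=; ring.
have rhs : \sum_(p <- r) \sum_(x <- r)
    ((x != p)%:R + (cmp u x * (1 - cmp u p) + cmp u p * (1 - cmp u x))) =
    (size r)%:R * ((size r)%:R - 1) + 2 * (S * ((size r)%:R - S)).
  rewrite (eq_big_seq (fun p => ((size r)%:R - 1) +
     (S * (1 - cmp u p) + ((size r)%:R - S) * cmp u p))); last first.
    move=> p pr; rewrite !big_split /= -mulr_suml -mulr_sumr sumrB sumr_const_seq.
    congr (_ + (_ + _)); last by rewrite mulr1 mulrC.
    rewrite (bigD1_seq p) //= eqxx add0r -big_filter.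
    rewrite (eq_big_seq (fun=> 1)); last by move=> x; rewrite mem_filter => /andP[->].
    rewrite sumr_const_seq -rem_filter // size_rem //.
    by case: (size r) m1 => [|k] //=; [rewrite ler10|rewrite -natr1; lra].
  rewrite !big_split /= -!mulr_sumr sumrB !sumr_const_seq -/S; ring.
(* With m = [size r], S (m - S) <= m^2 / 4, so the total is at most (m + 1) + 3/4 m^2 - m/2, which
   is below 3/4 (m + 1)^2 for m >= 1. *)
have sq : 0 <= (2 * S - (size r)%:R) ^+ 2 by rewrite sqr_ge0.
rewrite rhs dbl in hS; rewrite ks; nra.
Qed.

(** Concavity of [ln] in the place of Jensen's inequality: the bound is affine in [x], so an
    expectation passes through it. *)
Lemma ln_tangent (a x : R) : 0 < a -> 0 < x -> ln x <= ln a + x / a - 1.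
Proof.
move=> a0 x0; have xa : 0 < x / a by rewrite divr_gt0.
have -> : ln x = ln a + ln (x / a).
  by rewrite -lnM ?posrE // mulrCA divff ?mulr1 ?gt_eqF.
have := @le_ln1Dx R (x / a - 1); rewrite (_ : 1 + (x / a - 1) = x / a); last by ring.
by move=> /(_ _); lra.
Qed.

(** The comparisons of [u] and [v] with [p] are independent. A pivot equal to one of them separates
    them according to the other comparison alone, whence the factors 1. *)
Lemma Emask_separated (p u v : nat) (s : seq nat) :
  uniq s -> u \in s -> v \in s -> u != v ->
  Emask (cmp^~ p) (rem p s) (fun m =>
    ((p == u) || (u \in mask m (rem p s)))%:R *
    ((p == v) || (v \notin mask m (rem p s)))%:R) =
  (if p == u then 1 else cmp u p) * (if p == v then 1 else 1 - cmp v p).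
Proof.
move=> us uins vins nuv; set os := rem p s.
have uos : uniq os by rewrite rem_uniq.
have xos x : x \in s -> p != x -> x \in os.
  by move=> xs npx; rewrite mem_rem_uniq // inE eq_sym npx.
have [pu|npu] := eqVneq p u.
  have npv : p != v by rewrite pu.
  rewrite (negPf npv) (eq_Emask (fun m => 1 + - 1 * (v \in mask m os)%:R)).
    by rewrite EmaskD EmaskZ Emask_const Emask_mem1 ?xos //; ring.
  by move=> m _ /=; case: (v \in _) => /=; ring.
have [pv|npv] := eqVneq p v.
  rewrite (eq_Emask (fun m => (u \in mask m os)%:R)) ?Emask_mem1 ?xos ?mulr1 //.
  by move=> m _; rewrite mulr1.
rewrite (eq_Emask (fun m => (u \in mask m os)%:R +
  - 1 * ((u \in mask m os)%:R * (v \in mask m os)%:R))).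
  by rewrite EmaskD EmaskZ Emask_mem2 ?Emask_mem1 ?xos //; ring.
by move=> m _ /=; case: (u \in _); case: (v \in _) => /=; ring.
Qed.

(* At a pivot [p], [u] is wrongly separated from [v] with probability at most
   [eps]; otherwise the recursive call is on the part containing [u], whose
   expected size is at most [3 / 4] of the whole, so each level costs [eps] and
   decreases the potential [ln] by [ln (4 / 3)]. *)
Lemma before_le (eps : R) (u v : nat) f (s : seq nat) :
  0 <= eps -> u != v -> uniq s -> u \in s -> v \in s ->
  (forall p, p \in s -> (if p == u then 1 else cmp u p) *
                        (if p == v then 1 else 1 - cmp v p) <= eps) ->
  before cmp f s u v <= eps * (ln (size s)%:R / ln (4 / 3)).
Proof.
move=> eps0 nuv; elim: f s => [|f IH] s us uins vins heps.
  rewrite /= mulr_ge0 // divr_ge0 // ln_ge0 //; first by rewrite ler1n; case: s uins {us vins heps}.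
  lra.
have A0 : 0 < ln (4 / 3 : R) by rewrite ln_gt0 //; lra.
have s2 : (1 < size s)%N.
  have := uniq_leq_size (s1 := [:: u; v]) (s2 := s); rewrite /= inE nuv => -> // x.
  by rewrite !inE => /orP[] /eqP->.
set k : R := (size s)%:R.
have k0 : 0 < k by rewrite ltr0n; lia.
set A : R := (ln (4 / 3))^-1.
have Ap : 0 < A by rewrite invr_gt0.
(* [c0] is the constant term of the tangent to [ln] at 3/4 k, the bound on the mean part size. *)
pose c0 := ln (3 / 4 * k) - 1.
have split_le p m : p \in s -> size m = size (rem p s) ->
  split_value (fun t => before cmp f t u v) p (rem p s) u v m <=
  ((p == u) || (u \in mask m (rem p s)))%:R * ((p == v) || (v \notin mask m (rem p s)))%:R
  + eps * A * (c0 + (3 / 4 * k)^-1 * part_size p (rem p s) u m).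
  move=> ps sm; set os := rem p s in sm *.
  have uos : uniq os by rewrite rem_uniq.
  have sos x : x \in os -> x \in s by apply: mem_rem.
  have nos : p \notin os by rewrite mem_rem_uniq // inE eqxx.
  have xos x : x \in s -> p != x -> x \in os.
    by move=> xs npx; rewrite mem_rem_uniq // inE eq_sym npx.
  have ppos : 1 <= part_size p os u m.
    rewrite /part_size; have [//|npu] := eqVneq p u.
    rewrite (bigD1_seq u) ?xos //= eqxx lerDl sumr_ge0 //.
  have lnp : ln (part_size p os u m) <= c0 + (3 / 4 * k)^-1 * part_size p os u m.
    have := @ln_tangent (3 / 4 * k) (part_size p os u m); rewrite /c0 [_^-1 * _]mulrC.
    move=> /(_ _ _); rewrite -addrA (addrC (_ / _)) addrA; apply; last by lra.
    by rewrite mulr_gt0 //; lra.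
  apply: (@le_trans _ _ (((p == u) || (u \in mask m os))%:R *
     ((p == v) || (v \notin mask m os))%:R + eps * A * ln (part_size p os u m))); last first.
    by rewrite lerD2l ler_wpM2l // mulr_ge0 // ltW.
  have lnp0 : 0 <= eps * A * ln (part_size p os u m).
    by rewrite !mulr_ge0 ?ln_ge0 // ltW.
  rewrite /split_value /=; have [pu|npu] := eqVneq p u.
    have -> : (u \in mask m os) = false.
      by apply: (contraNF _ nos) => /mem_mask; rewrite pu.
    rewrite pu in lnp0 *; rewrite [v == u]eq_sym (negPf nuv) /=.
    by case: (v \in _) => /=; rewrite ?mulr0 ?mulr1 ?add0r ?lerDl.
  have [pv|npv] := eqVneq p v.
    have -> : (v \in mask m os) = false.
      by apply: (contraNF _ nos) => /mem_mask; rewrite pv.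
    rewrite /=.
    by case: (u \in _) => /=; rewrite ?mul0r ?mulr1 ?add0r ?lerDl.
  rewrite /=.
  have IH' t : uniq t -> u \in t -> v \in t -> {subset t <= os} ->
      (size t)%:R = part_size p os u m ->
      before cmp f t u v <= eps * A * ln (part_size p os u m).
    move=> ut uint vint tos <-; rewrite -mulrA [A * _]mulrC.
    by apply: IH => // q /tos /sos /heps.
  have [uL|uL] := boolP (u \in mask m os); have [vL|vL] := boolP (v \in mask m os) => //=.
  - rewrite mulr0 add0r; apply: IH' => //; first by rewrite mask_uniq.
      by move=> x /mem_mask.
    rewrite /part_size (negPf npu) uL (mask_filter_mem m uos) size_filter_sum.
    by apply: eq_bigr => x _; rewrite -mask_filter_mem // eqb_id.
  - by rewrite mulr1 lerDl.
  - by rewrite mul0r add0r.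
  - rewrite mul0r add0r mask_negb //; apply: IH'.
    + by rewrite filter_uniq.
    + by rewrite mem_filter uL xos.
    + by rewrite mem_filter vL xos.
    + by move=> x; rewrite mem_filter => /andP[].
    + rewrite /part_size (negPf npu) (negPf uL) size_filter_sum.
      by apply: eq_bigr => x _; rewrite eqbF_neg.
have Ele p : p \in s -> Emask (cmp^~ p) (rem p s)
   (split_value (fun t => before cmp f t u v) p (rem p s) u v) <=
   (eps + eps * A * c0) + eps * A * (3 / 4 * k)^-1 *
     Emask (cmp^~ p) (rem p s) (part_size p (rem p s) u).
  move=> ps.
  apply: le_trans (Emask_le (cmp01^~ p) (fun m => @split_le p m ps)) _.
  rewrite EmaskD EmaskZ EmaskD EmaskZ Emask_const Emask_separated //.
  rewrite mulrDr !addrA mulrA !lerD2r; exact: heps.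
rewrite beforeS ler_pdivrMl // -/k.
(* Since [A * ln (4 / 3) = 1], the cost [eps] of the level is exactly the decrease of the
   potential. *)
have -> : k * (eps * (ln k / ln (4 / 3))) =
    k * (eps + eps * A * c0) + eps * A * (3 / 4 * k)^-1 * (3 / 4 * k ^+ 2).
  have -> : c0 = ln k - ln (4 / 3) - 1.
    have q0 : 0 < 4 / 3 :> R by lra.
    have q1 : 3 / 4 = (4 / 3)^-1 :> R by rewrite invf_div.
    rewrite /c0 q1 lnM ?posrE ?invr_gt0 //.
    by rewrite [ln (_^-1)]lnV ?posrE // [- _ + _]addrC.
  rewrite /A; field; rewrite !gt_eqF //; lra.
apply: le_trans (ler_sum_seq Ele) _.
rewrite big_split /= sumr_const_seq -mulr_sumr lerD2l ler_wpM2l ?sum_part_size //.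
by rewrite !mulr_ge0 ?invr_ge0 ?mulr_ge0 //; try exact: ltW; lra.
Qed.

End QuicksortBounds.

(** * Inexact comparisons *)

Lemma bit_pow2D n x j : (j < n)%N -> bit (2 ^ n + x) j = bit x j.
Proof.
move=> jn; rewrite /bit -(subnK (ltnW jn)) expnD divnMDl ?expn_gt0 // oddD.
by rewrite oddX orbF subn_eq0 leqNgt jn.
Qed.

Lemma bit_small n x : (x < 2 ^ n)%N -> bit x n = false.
Proof. by move=> xn; rewrite /bit divn_small. Qed.

Lemma bit_pow2D_top n x : (x < 2 ^ n)%N -> bit (2 ^ n + x) n = true.
Proof. by move=> xn; rewrite /bit divnDl // divnn expn_gt0 divn_small. Qed.

Lemma pow2S_cases n x : (x < 2 ^ n.+1)%N ->
  (x < 2 ^ n)%N \/ exists2 y, (y < 2 ^ n)%N & x = (2 ^ n + y)%N.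
Proof.
move=> xn; have [|le] := ltnP x (2 ^ n); [by left | right].
by exists (x - 2 ^ n)%N; move: xn; rewrite expnS; lia.
Qed.

Section ReadProbability.
Variables (R : realType) (e : nat -> R).

Lemma sum_pow2S n (G : nat -> R) :
  \sum_(x < 2 ^ n.+1) G x = \sum_(x < 2 ^ n) G x + \sum_(x < 2 ^ n) G (2 ^ n + x)%N.
Proof. by rewrite expnS mul2n -addnn big_split_ord. Qed.

(* The probability that bit [n] of [x] is read as 1. *)
Definition top1 n x : R :=
  if bit x n then 1 - flipprob e n.+1 else flipprob e n.+1.

Lemma readprob_ext n x y x' y' : (forall j, (j < n)%N -> bit x j = bit y j) ->
  (forall j, (j < n)%N -> bit x' j = bit y' j) ->
  readprob n e x x' = readprob n e y y'.
Proof. by move=> h h'; apply: eq_bigr => j _; rewrite h // h'. Qed.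

Lemma readprobS0 n x x' : (x' < 2 ^ n)%N ->
  readprob n.+1 e x x' = (1 - top1 n x) * readprob n e x x'.
Proof.
move=> lt; rewrite /readprob big_ord_recr /= (bit_small lt) mulrC /top1.
by case: (bit x n) => //=; rewrite subKr.
Qed.

Lemma readprobS1 n x x' : (x' < 2 ^ n)%N ->
  readprob n.+1 e x (2 ^ n + x')%N = top1 n x * readprob n e x x'.
Proof.
move=> lt; rewrite /readprob big_ord_recr /= (bit_pow2D_top lt) mulrC /top1.
congr (_ * _); first by case: (bit x n).
by apply: (@readprob_ext n x x) => // j jn; rewrite bit_pow2D.
Qed.

Lemma sum_readprob n x : \sum_(x' < 2 ^ n) readprob n e x x' = 1.
Proof.
elim: n => [|n IH]; first by rewrite big_ord1 /readprob big_ord0.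
rewrite (sum_pow2S n (readprob n.+1 e x)).
under eq_bigr do rewrite readprobS0 //.
under [X in _ + X]eq_bigr do rewrite readprobS1 //.
by rewrite -!mulr_sumr IH; ring.
Qed.

(** The top bits decide when they are read differently; otherwise the lower [n] bits do. This
    recursion carries every estimate on comparisons. *)
Lemma ltprobS n x p :
  ltprob n.+1 e x p = (1 - top1 n x) * top1 n p +
    (top1 n x * top1 n p + (1 - top1 n x) * (1 - top1 n p)) * ltprob n e x p.
Proof.
pose ker (x' p' : nat) : R := if (x' < p')%N then 1 else if x' == p' :> nat then 2^-1 else 0.
pose r y y' := readprob n.+1 e y y'; pose r0 y y' := readprob n e y y'.
rewrite [LHS]/ltprob (sum_pow2S n (fun x' => \sum_(p' < 2 ^ n.+1) r x x' * r p p' * ker x' p')).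
under eq_bigr => x' _ do
  rewrite (sum_pow2S n (fun p' => r x x' * r p p' * ker x' p')).
under [X in _ + X]eq_bigr => x' _ do
  rewrite (sum_pow2S n (fun p' => r x (2 ^ n + x')%N * r p p' * ker (2 ^ n + x')%N p')).
rewrite !big_split /=.
(* Four blocks, by the top bit read (L for 0, H for 1) in [x], then in [p]. *)
have LL : \sum_(x' < 2 ^ n) \sum_(p' < 2 ^ n) r x x' * r p p' * ker x' p' =
    (1 - top1 n x) * (1 - top1 n p) * ltprob n e x p.
  rewrite mulr_sumr; apply: eq_bigr => x' _; rewrite mulr_sumr; apply: eq_bigr => p' _.
  by rewrite /r !readprobS0 // -/(ker x' p'); ring.
have LH : \sum_(x' < 2 ^ n) \sum_(p' < 2 ^ n) r x x' * r p (2 ^ n + p')%N * ker x' (2 ^ n + p')%N =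
    (1 - top1 n x) * top1 n p.
  transitivity (\sum_(x' < 2 ^ n) (1 - top1 n x) * top1 n p * r0 x x').
    apply: eq_bigr => x' _.
    transitivity (\sum_(p' < 2 ^ n) (1 - top1 n x) * top1 n p * r0 x x' * r0 p p').
      apply: eq_bigr => p' _; rewrite /r readprobS0 // readprobS1 // /ker.
      by rewrite (leq_trans (ltn_ord x') (leq_addr _ _)) /r0; ring.
    by rewrite -mulr_sumr sum_readprob mulr1.
  by rewrite -mulr_sumr sum_readprob mulr1.
have HL : \sum_(x' < 2 ^ n) \sum_(p' < 2 ^ n) r x (2 ^ n + x')%N * r p p' * ker (2 ^ n + x')%N p' = 0.
  apply: big1 => x' _; apply: big1 => p' _; rewrite /ker.
  rewrite ltnNge (leq_trans (ltnW (ltn_ord p')) (leq_addr _ _)) /=.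
  by rewrite gtn_eqF ?mulr0 // (leq_trans (ltn_ord p')) ?leq_addr.
have HH : \sum_(x' < 2 ^ n) \sum_(p' < 2 ^ n) r x (2 ^ n + x')%N * r p (2 ^ n + p')%N *
     ker (2 ^ n + x')%N (2 ^ n + p')%N = top1 n x * top1 n p * ltprob n e x p.
  rewrite mulr_sumr; apply: eq_bigr => x' _; rewrite mulr_sumr; apply: eq_bigr => p' _.
  by rewrite /r !readprobS1 // /ker ltn_add2l eqn_add2l -/(ker x' p'); ring.
by rewrite LL LH HL HH /=; ring.
Qed.

Lemma ltprob0 x p : ltprob 0 e x p = 2^-1.
Proof. by rewrite /ltprob !big_ord1 /readprob !big_ord0 /= !mul1r. Qed.

Lemma ltprob_pow2Dl n x p : ltprob n e (2 ^ n + x)%N p = ltprob n e x p.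
Proof.
apply: eq_bigr => x' _; apply: eq_bigr => p' _; congr (_ * _ * _).
by apply: readprob_ext => // j; apply: bit_pow2D.
Qed.

Lemma ltprob_pow2Dr n x p : ltprob n e x (2 ^ n + p)%N = ltprob n e x p.
Proof.
apply: eq_bigr => x' _; apply: eq_bigr => p' _; congr (_ * _ * _).
by apply: readprob_ext => // j; apply: bit_pow2D.
Qed.

Lemma ltprobC n x p : ltprob n e x p + ltprob n e p x = 1.
Proof.
elim: n => [|n IH]; first by rewrite !ltprob0; lra.
rewrite !ltprobS (_ : ltprob n e p x = 1 - ltprob n e x p); [ring | lra].
Qed.

Hypothesis flip_half : forall j, 0 < flipprob e j.+1 <= 2^-1.

Lemma top1_01 n x : 0 < top1 n x < 1.
Proof. by rewrite /top1; have := flip_half n; case: ifP => _; lra. Qed.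

Lemma ltprob01 n x p : 0 <= ltprob n e x p <= 1.
Proof.
elim: n => [|n IH]; first by rewrite ltprob0; lra.
rewrite ltprobS; have := top1_01 n x; have := top1_01 n p; move: IH.
move: (top1 n x) (top1 n p) (ltprob n e x p) => a b t /andP[t0 t1] /andP[b0 b1] /andP[a0 a1].
have ab : 0 <= a * b by rewrite mulr_ge0 ?ltW.
have a'b' : 0 <= (1 - a) * (1 - b) by rewrite mulr_ge0; lra.
have a'b : 0 <= (1 - a) * b by rewrite mulr_ge0; lra.
have ab' : 0 <= a * (1 - b) by rewrite mulr_ge0; lra.
have : 0 <= (a * b + (1 - a) * (1 - b)) * t by rewrite mulr_ge0; lra.
have : 0 <= (a * b + (1 - a) * (1 - b)) * (1 - t) by rewrite mulr_ge0; lra.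
by move=> h1 h2; apply/andP; split; lra.
Qed.

(** One flip, in the appropriate number, makes the equal top bits read as 0 in [x] and 1 in [p];
    this has probability f (1 - f) >= f / 2. *)
Lemma ltprob_same_top n x p : bit x n = bit p n ->
  flipprob e n.+1 / 2 <= ltprob n.+1 e x p.
Proof.
move=> xp; rewrite ltprobS /top1 xp; have := flip_half n; have := ltprob01 n x p.
move: (flipprob _ _) (ltprob _ _ _ _) => f t /andP[t0 t1] /andP[f0 f1].
have : 0 <= (f * f + (1 - f) * (1 - f)) * t.
  by apply: mulr_ge0; [apply: addr_ge0; apply: mulr_ge0; lra | lra].
have : 0 <= f * (2^-1 - f) by rewrite mulr_ge0; lra.
by case: (bit p n) => /=; lra.
Qed.

(** Either both top bits flip, or exactly one does and the lower bits decide. *)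
Lemma ltprob_diff_top n x p : bit x n -> bit p n = false ->
  ltprob n.+1 e x p = flipprob e n.+1 ^+ 2 +
    2 * flipprob e n.+1 * (1 - flipprob e n.+1) * ltprob n e x p.
Proof. by move=> xn pn; rewrite ltprobS /top1 xn pn; ring. Qed.

(** Different top bits are both read correctly with probability (1 - f)^2 >= 1/4. Equal ones give f
    (1 - f) + (1 - 2 f (1 - f)) t, which is at least 1/4 if t is. *)
Lemma ltprob_ge_quarter n x p : (x <= p)%N -> (p < 2 ^ n)%N ->
  4^-1 <= ltprob n e x p.
Proof.
elim: n x p => [|n IH] x p xp pn; first by rewrite ltprob0; lra.
have f01 := flip_half n; move: f01 => /andP[f0 f1].
have same y z : (y <= z)%N -> (z < 2 ^ n)%N -> bit x n = bit p n ->
    ltprob n e x p = ltprob n e y z -> 4^-1 <= ltprob n.+1 e x p.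
  move=> yz zn bxp E; rewrite ltprobS E /top1 bxp.
  have := IH _ _ yz zn; have := ltprob01 n y z.
  move: (flipprob _ _) (ltprob _ _ _ _) f0 f1 => f t f0 f1 /andP[t0 t1] t4.
  have : 0 <= (f * f + (1 - f) * (1 - f)) * (t - 4^-1).
    by apply: mulr_ge0; [apply: addr_ge0; apply: mulr_ge0; lra | lra].
  have : 0 <= f * (1 - f) by rewrite mulr_ge0; lra.
  by case: (bit p n) => /=; lra.
have [xn|[y yn xE]] := pow2S_cases (leq_ltn_trans xp pn);
  have [p_n|[z zn pE]] := pow2S_cases pn.
- by apply: (same x p) => //; rewrite !bit_small.
- rewrite ltprobS /top1 (bit_small xn) pE bit_pow2D_top //.
  have := ltprob01 n x (2 ^ n + z)%N.
  move: (flipprob _ _) (ltprob _ _ _ _) f0 f1 {pE} => f t f0 f1 /andP[t0 t1].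
  have : 0 <= f * (1 - f) * t by apply: mulr_ge0; [apply: mulr_ge0|]; lra.
  have : 0 <= (2^-1 - f) * (1 - f) by rewrite mulr_ge0; lra.
  by lra.
- by lia.
- apply: (same y z) => //; first by lia.
    by rewrite xE pE !bit_pow2D_top.
  by rewrite xE pE ltprob_pow2Dl ltprob_pow2Dr.
Qed.

End ReadProbability.

(** * Comparison errors for the two energy vectors *)

Section EnergyVectors.
Variable R : realType.

Lemma flipprob_ea j : flipprob (e_a R) j = (2 ^+ j)^-1.
Proof. by rewrite /flipprob /e_a powRN powR_mulrn. Qed.

Lemma flip_half_ea j : 0 < flipprob (e_a R) j.+1 <= 2^-1.
Proof.
rewrite flipprob_ea invr_gt0 exprn_gt0 //= lef_pV2 ?posrE ?exprn_gt0 //.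
by rewrite exprS ler_peMr // exprn_ege1 // ler1n.
Qed.

Lemma flip_half_eo n j : (0 < n)%N -> 0 < flipprob (e_o R n) j.+1 <= 2^-1.
Proof.
move=> n0; rewrite /flipprob /e_o powR_gt0 //= powRN lef_pV2 ?posrE ?powR_gt0 //.
rewrite -[leLHS]powRr1 // ler_powR ?ler1n //.
have : 2 <= n.+1%:R :> R by rewrite ler_nat.
lra.
Qed.

(** The subtracted term strengthens the induction: an equal top bit adds at most f = 2^(-(n+1)),
    which is what 2^(-n) exceeds 2^(-(n+1)) by. If the top bits differ, then f <= 1/d with d = x -
    p, and the error is at most 2f <= 4/d - f. *)
Lemma ltprob_ea_le n x p : (p < x)%N -> (x < 2 ^ n)%N ->
  ltprob n (e_a R) x p <= 4 / (x - p)%:R - (2 ^+ n)^-1.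
Proof.
elim: n x p => [|n IH] x p px xn; first by move: xn; rewrite expn0; lia.
have f01 := flip_half_ea n; move: f01 => /andP[f0 f1].
have fE : (2 ^+ n)^-1 = 2 * flipprob (e_a R) n.+1.
  by rewrite flipprob_ea exprS invfM mulrA divff ?mul1r // pnatr_eq0.
have same y z : (z < y)%N -> (y < 2 ^ n)%N -> bit x n = bit p n ->
    (y - z = x - p)%N -> ltprob n (e_a R) x p = ltprob n (e_a R) y z ->
    ltprob n.+1 (e_a R) x p <= 4 / (x - p)%:R - (2 ^+ n.+1)^-1.
  move=> zy yn bxp <- E; rewrite ltprobS E /top1 bxp -flipprob_ea.
  have := IH _ _ zy yn; have := ltprob01 flip_half_ea n y z; rewrite fE.
  move: (flipprob _ _) (ltprob _ _ _ _) (4 / _) f0 f1 {fE} => f t d f0 f1 /andP[t0 t1] td.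
  have : 0 <= f * (1 - f) * t by apply: mulr_ge0; [apply: mulr_ge0|]; lra.
  have : 0 <= f * f by rewrite ?mulr_ge0 //; lra.
  by case: (bit p n) => /=; lra.
have [x_n|[y yn xE]] := pow2S_cases xn;
  have [p_n|[z zn pE]] := pow2S_cases (ltn_trans px xn).
- by apply: (same x p) => //; rewrite !bit_small.
- by lia.
- rewrite ltprob_diff_top ?xE ?bit_pow2D_top ?bit_small // -xE -flipprob_ea.
  have d_le : flipprob (e_a R) n.+1 <= (x - p)%:R^-1.
    rewrite flipprob_ea lef_pV2 ?posrE ?exprn_gt0 ?ltr0n ?subn_gt0 //.
    rewrite -natrX ler_nat; lia.
  have := ltprob01 flip_half_ea n x p.
  move: (flipprob _ _) (ltprob _ _ _ _) ((x - p)%:R^-1) f0 f1 d_le {fE same xE}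
    => f t d f0 f1 d_le /andP[t0 t1].
  have : 0 <= f * (1 - f) * (1 - t) by apply: mulr_ge0; [apply: mulr_ge0|]; lra.
  have : 0 <= f * f by rewrite ?mulr_ge0 //; lra.
  by nra.
- apply: (same y z) => //; try lia.
    by rewrite xE pE !bit_pow2D_top.
  by rewrite xE pE ltprob_pow2Dl ltprob_pow2Dr.
Qed.

End EnergyVectors.

(** * Weighted inversions of an array *)

Definition near (w x y : nat) : bool := (x < y + w)%N && (y < x + w)%N.

(* Nearness of the values without their top bit matters only when [N = 2]. *)
Definition close (n w x y : nat) : bool :=
  near w x y || near w (x %% 2 ^ n.-1) (y %% 2 ^ n.-1).

Definition nclose (n w N : nat) (C : {ffun 'I_N -> 'I_(2 ^ n)}) : nat :=
  \sum_(a < N) \sum_(b < N) ((a != b) && close n w (C a) (C b)).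

Section Inversions.
Variable R : realType.

Lemma distr_natE (x y : nat) : (y <= x)%N -> `|x%:R - y%:R| = (x - y)%:R :> R.
Proof. by move=> yx; rewrite -natrB // normr_nat. Qed.

Lemma PrQC n (e : nat -> R) s u v : u != v -> PrQ n e s u v = PrQ n e s v u.
Proof. by rewrite /PrQ; case: ltngtP. Qed.

Lemma PrQ_gt n (e : nat -> R) s u v : (v < u)%N ->
  PrQ n e s u v = before (ltprob n e) (size s) s u v.
Proof. by rewrite /PrQ => vu; case: ltngtP vu. Qed.

(* One of the two comparisons of [u] and [v] with [p] is over a distance of at
   least half of [u - v]. *)
Lemma ea_wrong_split n (u v p : nat) : (v < u)%N -> (u < 2 ^ n)%N -> (p < 2 ^ n)%N ->
  (if p == u then 1 else ltprob n (e_a R) u p) *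
  (if p == v then 1 else 1 - ltprob n (e_a R) v p) <= 8 / (u - v)%:R.
Proof.
move=> vu un pn; have c01 := ltprob01 (@flip_half_ea R) n.
have d0 : (0 : R) < (u - v)%:R by rewrite ltr0n; lia.
have pw : 0 <= (2 ^+ n)^-1 :> R by rewrite invr_ge0 exprn_ge0.
have far x y : (y < x)%N -> (x < 2 ^ n)%N -> (u - v <= 2 * (x - y))%N ->
    ltprob n (e_a R) x y <= 8 / (u - v)%:R.
  move=> yx xn le; apply: (le_trans (ltprob_ea_le R yx xn)).
  apply: (@le_trans _ _ (4 / (x - y)%:R)); first by rewrite lerBlDr lerDl.
  rewrite ler_pdivrMr ?ltr0n ?subn_gt0 // mulrAC ler_pdivlMr //.
  have : (u - v)%:R <= 2 * (x - y)%:R :> R by rewrite -natrM ler_nat.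
  by lra.
have u01 : 0 <= (if p == u then 1 else ltprob n (e_a R) u p) <= 1.
  by have := c01 u p; case: ifP => _; lra.
have v01 : 0 <= (if p == v then 1 else 1 - ltprob n (e_a R) v p) <= 1.
  by have := c01 v p; case: ifP => _; lra.
have [le|lt] := leqP (u - v) (2 * (u - p)).
  apply: (@le_trans _ _ (if p == u then 1 else ltprob n (e_a R) u p)).
    by rewrite ler_piMr //; lra.
  by rewrite ltn_eqF ?far //; lia.
apply: (@le_trans _ _ (if p == v then 1 else 1 - ltprob n (e_a R) v p)).
  by rewrite ler_piMl //; lra.
rewrite gtn_eqF; last by lia.
rewrite (_ : 1 - _ = ltprob n (e_a R) p v) ?far //; try lia.
by have := ltprobC (e_a R) n v p; lra.
Qed.

(** The weight cancels the value 8 / |u - v| taken for [eps] in [before_le], so the bound is the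
    same for all pairs. *)
Lemma PrQ_ea_le n s u v : uniq s -> {in s, forall x, x < 2 ^ n}%N ->
  u \in s -> v \in s -> u != v ->
  `|u%:R - v%:R| * PrQ n (e_a R) s u v <= 8 * (ln (size s)%:R / ln (4 / 3)).
Proof.
move=> us sn; wlog vu : u v / (v < u)%N => [H|] uins vins nuv.
  have /orP[uv|vu] : (u < v)%N || (v < u)%N by lia.
    by rewrite PrQC // distrC H // eq_sym.
  exact: H.
rewrite PrQ_gt // distr_natE ?(ltnW vu) //.
have d0 : (0 : R) < (u - v)%:R by rewrite ltr0n; lia.
have := @before_le R _ (ltprob01 (@flip_half_ea R) n) (fun x y _ => ltprobC (e_a R) n x y)
  (8 / (u - v)%:R) u v (size s) s.
move=> /(_ _ nuv us uins vins) le.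
rewrite -ler_pdivlMl // mulrCA mulrA; apply: le; first by rewrite divr_ge0 // ltW.
by move=> p ps; apply: ea_wrong_split => //; apply: sn.
Qed.

Lemma PrQ_ge n (e : nat -> R) s u v : (forall j, 0 < flipprob e j.+1 <= 2^-1) ->
  uniq s -> u \in s -> v \in s -> u != v ->
  (size s)%:R^-1 * ltprob n e (maxn u v) (minn u v) <= PrQ n e s u v.
Proof.
move=> e2 us; wlog vu : u v / (v < u)%N => [H|] uins vins nuv.
  have /orP[uv|vu] : (u < v)%N || (v < u)%N by lia.
    by rewrite PrQC // maxnC minnC H // eq_sym.
  exact: H.
rewrite PrQ_gt // (maxn_idPl (ltnW vu)) (minn_idPr (ltnW vu)).
by apply: before_ge_cmp => // x y; apply: ltprob01.
Qed.

Lemma PrQ_ge0 n (e : nat -> R) s u v : (forall j, 0 < flipprob e j.+1 <= 2^-1) ->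
  0 <= PrQ n e s u v.
Proof. by move=> e2; rewrite /PrQ; case: ifP => _; apply: before_ge0 => x y; apply: ltprob01. Qed.

Lemma ltprob_gt0 n (e : nat -> R) x p : (forall j, 0 < flipprob e j.+1 <= 2^-1) ->
  0 < ltprob n e x p.
Proof.
move=> e2; case: n => [|n]; first by rewrite ltprob0 invr_gt0.
rewrite ltprobS; have := top1_01 e2 n x; have := top1_01 e2 n p; have := ltprob01 e2 n x p.
move: (top1 _ _ _) (top1 _ _ _) (ltprob _ _ _ _) => a b t /andP[t0 t1] /andP[b0 b1] /andP[a0 a1].
have : 0 < (1 - a) * b by rewrite mulr_gt0; lra.
have : 0 <= (a * b + (1 - a) * (1 - b)) * t.
  by apply: mulr_ge0 => //; apply: addr_ge0; apply: mulr_ge0; lra.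
by lra.
Qed.

Section Array.
Variables (n N : nat) (C : {ffun 'I_N -> 'I_(2 ^ n)}).

Lemma size_arr : size (arr_seq C) = N.
Proof. by rewrite size_map size_enum_ord. Qed.

Lemma nth_arr (a : 'I_N) : nth 0%N (arr_seq C) a = C a.
Proof. by rewrite (nth_map a) ?size_enum_ord // nth_ord_enum. Qed.

Lemma mem_arr (a : 'I_N) : (C a : nat) \in arr_seq C.
Proof. by rewrite /arr_seq; apply/mapP; exists a => //; rewrite mem_enum. Qed.

Lemma arr_lt : {in arr_seq C, forall x, x < 2 ^ n}%N.
Proof. by move=> x /mapP[a _ ->]; apply: ltn_ord. Qed.

Lemma wktE (e : nat -> R) : wkt n e (arr_seq C) =
  \sum_(a < N) \sum_(b < N | (a < b)%N)
     `|(C a : nat)%:R - (C b : nat)%:R| * PrQ n e (arr_seq C) (C a) (C b).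
Proof.
rewrite /wkt.
pose F a b : R := `|(nth 0%N (arr_seq C) a)%:R - (nth 0%N (arr_seq C) b)%:R| *
   PrQ n e (arr_seq C) (nth 0%N (arr_seq C) a) (nth 0%N (arr_seq C) b).
transitivity (\sum_(a < N) \sum_(b < N | (a < b)%N) F a b).
  by move: (arr_seq C) size_arr @F => s <-.
by apply: eq_bigr => a _; apply: eq_bigr => b _; rewrite /F !nth_arr.
Qed.

Hypothesis Cinj : injectiveb C.

Lemma arr_uniq : uniq (arr_seq C).
Proof.
rewrite map_inj_uniq ?enum_uniq // => a b /val_inj.
by move/injectiveP: Cinj => /[apply].
Qed.

Lemma arr_neq (a b : 'I_N) : a != b -> (C a : nat) != C b.
Proof.
by apply: contra => /eqP/val_inj; move/injectiveP: Cinj => /[apply] ->.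
Qed.

Lemma wkt_ea_le : wkt n (e_a R) (arr_seq C) <=
  N%:R ^+ 2 * (8 * (ln N%:R / ln (4 / 3))).
Proof.
rewrite wktE expr2 -mulrA.
have t0 : 0 <= 8 * (ln N%:R / ln (4 / 3)) :> R.
  case: N => [|k]; first by rewrite ln0 // mul0r mulr0.
  rewrite mulr_ge0 // divr_ge0 ?ln_ge0 ?ler1n //; lra.
move: t0; set t := 8 * _ => t0.
have -> : N%:R * (N%:R * t) = \sum_(a < N) \sum_(b < N) t.
  by rewrite !sumr_const !card_ord !mulr_natl.
apply: ler_sum => a _; rewrite big_mkcond /=; apply: ler_sum => b _.
case: ifP => // ab; have nab : (C a : nat) != C b.
  by apply: arr_neq; rewrite -val_eqE ltn_eqF.
have := PrQ_ea_le arr_uniq arr_lt (mem_arr a) (mem_arr b) nab.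
by rewrite size_arr.
Qed.

Lemma wkt_gt0 (e : nat -> R) : (1 < N)%N -> (forall j, 0 < flipprob e j.+1 <= 2^-1) ->
  0 < wkt n e (arr_seq C).
Proof.
move=> N1 e2; rewrite wktE.
pose a0 : 'I_N := Ordinal (ltnW N1); pose b0 : 'I_N := Ordinal N1.
have F0 a b : 0 <= `|(C a : nat)%:R - (C b : nat)%:R| * PrQ n e (arr_seq C) (C a) (C b).
  by rewrite mulr_ge0 // PrQ_ge0.
rewrite (bigD1 a0) //= (bigD1 b0) //=.
rewrite -addrA ltr_pwDl ?addr_ge0 ?sumr_ge0 // => [|a _]; last exact: sumr_ge0.
have nab : (C a0 : nat) != C b0 by apply: arr_neq.
rewrite mulr_gt0 //.
  by rewrite normr_gt0 subr_eq0 eqr_nat.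
apply: lt_le_trans (PrQ_ge n e2 arr_uniq (mem_arr a0) (mem_arr b0) nab).
by rewrite mulr_gt0 ?ltprob_gt0 // invr_gt0 ltr0n size_arr ltnW.
Qed.

(** Ordered pairs match the way [nclose] and [sum_same_class] count. *)
Lemma wkt_double (e : nat -> R) : 2 * wkt n e (arr_seq C) =
  \sum_(a < N) \sum_(b < N) (a != b)%:R *
    (`|(C a : nat)%:R - (C b : nat)%:R| * PrQ n e (arr_seq C) (C a) (C b)).
Proof.
rewrite wktE; pose F (a b : 'I_N) : R :=
  `|(C a : nat)%:R - (C b : nat)%:R| * PrQ n e (arr_seq C) (C a) (C b).
have FC a b : a != b -> F a b = F b a.
  by move=> nab; rewrite /F distrC PrQC // arr_neq.
transitivity (\sum_(a < N) \sum_(b < N) ((a < b)%N%:R * F a b + (b < a)%N%:R * F b a)).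
  under [RHS]eq_bigr do rewrite big_split.
  rewrite big_split /= [X in _ + X]exchange_big /= -[2]/(1 + 1) mulrDl mul1r.
  by congr (_ + _); apply: eq_bigr => a _; rewrite big_mkcond; apply: eq_bigr => b _;
    case: ifP; rewrite ?mul1r ?mul0r.
apply: eq_bigr => a _; apply: eq_bigr => b _; rewrite -/(F a b) -val_eqE.
have [ab|ba|/val_inj->] := ltngtP a b; rewrite ?mul0r ?mul1r ?addr0 ?add0r //.
by rewrite FC // -val_eqE ltn_eqF.
Qed.

End Array.
End Inversions.

(** * Distant pairs *)

Section Goodness.
Variable R : realType.

(** The exponent is 2n/3 rounded up: with q the flip probability of [e_o], 2 q w is at least
    2^(n/6), while w / 2^n is still O(2^(-n/3)). *)
Definition width (n : nat) : nat := 2 ^ ((2 * n + 2) %/ 3).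

Lemma widthE n : (width n)%:R = powR 2 ((2 * n + 2) %/ 3)%:R :> R.
Proof. by rewrite powR_mulrn // -natrX. Qed.

Lemma width_exp_ge n : 2 / 3 * n%:R <= ((2 * n + 2) %/ 3)%:R :> R.
Proof.
have : (2 * n)%:R <= (3 * ((2 * n + 2) %/ 3))%:R :> R by rewrite ler_nat; lia.
by rewrite !natrM; lra.
Qed.

Lemma width_exp_le n : ((2 * n + 2) %/ 3)%:R <= 2 / 3 * n%:R + 2 / 3 :> R.
Proof.
have : (3 * ((2 * n + 2) %/ 3))%:R <= (2 * n + 2)%:R :> R by rewrite ler_nat; lia.
by rewrite natrD !natrM; lra.
Qed.

Lemma eo_flip n j : flipprob (e_o R n) j = powR 2 (- (n.+1%:R / 2)).
Proof. by []. Qed.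

Lemma powR2D (x y : R) : powR 2 (x + y) = powR 2 x * powR 2 y.
Proof. by rewrite powRD // pnatr_eq0 implybT. Qed.

Lemma eo_flip_sqr n j : flipprob (e_o R n) j ^+ 2 = (2 ^+ n.+1)^-1.
Proof.
rewrite eo_flip expr2 -powR2D -[in RHS]powR_mulrn // -powRN; congr powR; lra.
Qed.

Lemma pow_sixth_le_flip_width n j :
  powR 2 (n%:R / 6) <= 2 * flipprob (e_o R n) j * (width n)%:R.
Proof.
rewrite eo_flip widthE -{2}[2](@powRr1 R) // -!powR2D ler_powR ?ler1n //.
have -> : n.+1%:R = n%:R + 1 :> R by rewrite -natr1.
by have := width_exp_ge n; have := ler0n R n; lra.
Qed.

Lemma pow_sixth_le_width n : powR 2 (n%:R / 6) <= (width n)%:R :> R.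
Proof.
rewrite widthE ler_powR ?ler1n //.
by have := width_exp_ge n; have := ler0n R n; lra.
Qed.

(** The three cases give the factors 16 (equal top bits), 32 (lower parts reversed or equal) and 18
    (lower parts in order); 768 is taken to match [good_const]. *)
Lemma far_pair_ratio n u v : (v < u)%N -> (u < 2 ^ n)%N -> (0 < n)%N ->
  ~~ close n (width n) u v ->
  powR 2 (n%:R / 6) * ltprob n (e_a R) u v <= 768 * ltprob n (e_o R n) u v.
Proof.
case: n => // n vu un _; rewrite /close negb_or => /andP[].
have eo2 j : 0 < flipprob (e_o R n.+1) j.+1 <= 2^-1 by apply: flip_half_eo.
set w := width n.+1; rewrite {1}/near negb_and -!leqNgt => nuv nlow.
have wn : (0 < w)%N by rewrite expn_gt0.
have w0 : 0 < w%:R :> R by rewrite ltr0n.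
have vw : (v + w <= u)%N by lia.
have X0 : 0 <= powR 2 (n.+1%:R / 6) :> R by rewrite powR_ge0.
have Xqw := pow_sixth_le_flip_width n.+1 n.+1; have Xw := pow_sixth_le_width n.+1.
rewrite -/w in Xqw Xw.
set X := powR 2 (n.+1%:R / 6) in X0 Xqw Xw *.
have := eo2 n; have := eo_flip_sqr n.+1 n.+1.
set q := flipprob _ _ in Xqw * => qq /andP[q0 q1].
have Pa_le : X * ltprob n.+1 (e_a R) u v <= 8 * q.
  apply: (@le_trans _ _ (2 * q * w%:R * (4 / w%:R))); last first.
    by rewrite le_eqVlt; apply/orP; left; apply/eqP; field; rewrite gt_eqF.
  apply: ler_pM => //; first by have /andP[] := ltprob01 (@flip_half_ea R) n.+1 u v.
  apply: (le_trans (ltprob_ea_le R vu un)).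
  apply: (@le_trans _ _ (4 / (u - v)%:R)).
    by rewrite lerBlDr lerDl invr_ge0 exprn_ge0.
  by rewrite ler_wpM2l // lef_pV2 ?posrE ?ltr0n ?ler_nat //; lia.
have [un'|[y yn uE]] := pow2S_cases un; have [vn'|[z zn vE]] := pow2S_cases (ltn_trans vu un).
- have := @ltprob_same_top R _ eo2 n u v; rewrite !bit_small // => /(_ erefl).
  by rewrite -/q; lra.
- by lia.
- have E (e : nat -> R) : ltprob n.+1 e u v = flipprob e n.+1 ^+ 2 +
    2 * flipprob e n.+1 * (1 - flipprob e n.+1) * ltprob n e y v.
    by rewrite ltprob_diff_top ?uE ?bit_pow2D_top ?bit_small // ltprob_pow2Dl.
  rewrite /near uE /= modnDl !modn_small // negb_and -!leqNgt in nlow.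
  (* If [y <= v], exactly one top flip, of probability 2 q (1 - q) >= q, leaves the decision to
     lower bits that err with probability at least 1/4. *)
  have [yv|vy] := leqP y v.
    apply: (le_trans Pa_le); rewrite E -/q.
    have := ltprob_ge_quarter eo2 yv vn'; move: (ltprob _ _ _ _) => t t4.
    have : 0 <= q * (2^-1 - q) * t by apply: mulr_ge0; [apply: mulr_ge0|]; lra.
    have : 0 <= q * (t - 4^-1) by apply: mulr_ge0; lra.
    have : 0 <= q ^+ 2 by rewrite sqr_ge0.
    by lra.
  have vwy : (v + w <= y)%N by lia.
  (* Here only q^2 = f / 2 is kept for [e_o], f being the top flip probability of [e_a]. [Pa_le] is
     too weak; instead X (f^2 + 2 f (1 - f) ta) <= 9 f, from ta <= 4 / w and X <= w. *)
  rewrite !E.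
  have := ltprob_ea_le R vy yn; have := ltprob01 (@flip_half_ea R) n y v.
  have := ltprob01 eo2 n y v; rewrite -/q qq flipprob_ea.
  have fE : (2 ^+ n.+2)^-1 = (2 ^+ n.+1)^-1 / 2 :> R by rewrite [in LHS]exprS invfM mulrC.
  have wf : w%:R * (2 ^+ n.+1)^-1 <= 1 :> R.
    rewrite ler_pdivrMr ?exprn_gt0 // mul1r -natrX ler_nat leq_exp2l //; lia.
  have dw : 4 / (y - v)%:R <= 4 / w%:R :> R.
    by rewrite ler_wpM2l // lef_pV2 ?posrE ?ltr0n ?ler_nat //; lia.
  have f0 : 0 < (2 ^+ n.+1)^-1 :> R by rewrite invr_gt0 exprn_gt0.
  have g0 : 0 < (2 ^+ n)^-1 :> R by rewrite invr_gt0 exprn_gt0.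
  have f1 : (2 ^+ n.+1)^-1 <= 2^-1 :> R by have /andP[] := flip_half_ea R n; rewrite flipprob_ea.
  rewrite fE; move: dw wf f0 g0 f1; move: ((2 ^+ n.+1)^-1) ((2 ^+ n)^-1) (4 / (y - v)%:R) => f g d.
  move: (ltprob _ _ _ _) (ltprob _ _ _ _) => ta tq dw wf f0 g0 f1 /andP[tq0 tq1] /andP[ta0 ta1] tad.
  have Xt : X * ta <= 4.
    apply: (@le_trans _ _ (w%:R * (4 / w%:R))); first by apply: ler_pM => //; lra.
    by rewrite mulrC divfK ?gt_eqF.
  have Xf : X * f <= 1 by apply: le_trans wf; rewrite ler_wpM2r // ltW.
  have h1 : X * f ^+ 2 <= f.
    by rewrite expr2 mulrA; apply: le_trans (ler_wpM2r (ltW f0) Xf) _; rewrite mul1r.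
  have h2 : f * (1 - f) * (X * ta) <= f * 4.
    by apply: ler_pM => //; nra.
  have h3 : 0 <= q * (1 - q) * tq by apply: mulr_ge0; [apply: mulr_ge0|]; lra.
  by lra.
- have := @ltprob_same_top R _ eo2 n u v; rewrite uE vE !bit_pow2D_top // -uE -vE => /(_ erefl).
  by rewrite -/q; lra.
Qed.

End Goodness.

(** * Good arrays *)

Lemma close_sym n w x y : close n w x y = close n w y x.
Proof. by rewrite /close /near andbC [X in _ || X]andbC. Qed.

Section GoodArrays.
Variable R : realType.

Lemma far_dist (w x y : nat) : ~~ near w x y -> w%:R <= `|x%:R - y%:R| :> R.
Proof.
rewrite /near negb_and -!leqNgt => /orP[] h.
  by rewrite distr_natE ?ler_nat; lia.
by rewrite distrC distr_natE ?ler_nat; lia.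
Qed.

Lemma ln43_gt0 : 0 < ln (4 / 3) :> R.
Proof. by rewrite ln_gt0 //; lra. Qed.

(** The only pivots are [u] and [v], so [before_le] applies with the exact error of their comparison
    as [eps]. The 1536 is 768 times the 2 from [PrQ_ge]. *)
Lemma PrQ_pair_ratio n s u v : uniq s -> size s = 2%N -> u \in s -> v \in s ->
  u != v -> (u < 2 ^ n)%N -> (v < 2 ^ n)%N -> (0 < n)%N ->
  ~~ close n (width n) u v ->
  powR 2 (n%:R / 6) * PrQ n (e_a R) s u v <=
  1536 * PrQ n (e_o R n) s u v * (ln 2 / ln (4 / 3)).
Proof.
move=> us s2; wlog vu : u v / (v < u)%N => [H|] uins vins nuv un vn n0 far.
  have /orP[uv|vu] : (u < v)%N || (v < u)%N by lia.
    by rewrite PrQC // [in leRHS]PrQC // H // 1?eq_sym // close_sym.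
  exact: H.
have X0 : 0 <= powR 2 (n%:R / 6) :> R by rewrite powR_ge0.
have L0 : 0 < ln 2 / ln (4 / 3) :> R by rewrite divr_gt0 ?ln43_gt0 // ln_gt0 // ltr1n.
have Pale : PrQ n (e_a R) s u v <= ltprob n (e_a R) u v * (ln 2 / ln (4 / 3)).
  have := @before_le R _ (ltprob01 (@flip_half_ea R) n) (fun x y _ => ltprobC (e_a R) n x y)
    (ltprob n (e_a R) u v) u v (size s) s.
  rewrite PrQ_gt // {2}s2; apply => //.
    by have /andP[] := ltprob01 (@flip_half_ea R) n u v.
  move=> p; have uv : uniq [:: u; v] by rewrite /= inE nuv.
  have sub : {subset [:: u; v] <= s} by move=> x; rewrite !inE => /orP[] /eqP->.
  have [|_ <-] := uniq_min_size uv sub; first by rewrite s2.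
  rewrite !inE => /orP[] /eqP->.
    rewrite eqxx (negPf nuv) mul1r.
    by rewrite -(ltprobC (e_a R) n v u) addrC addKr.
  by rewrite eqxx eq_sym (negPf nuv) mulr1.
have eo2 j : 0 < flipprob (e_o R n) j.+1 <= 2^-1 by apply: flip_half_eo.
have Poge := PrQ_ge n eo2 us uins vins nuv.
rewrite s2 (maxn_idPl (ltnW vu)) (minn_idPr (ltnW vu)) in Poge; clear s2.
have ratio := far_pair_ratio R vu un n0 far.
move: (ln 2 / _) L0 Pale => L L0 Pale.
apply: le_trans (ler_wpM2l X0 Pale) _; rewrite mulrA; apply: ler_wpM2r; first exact: ltW.
by apply: le_trans ratio _; lra.
Qed.

(** With h entries in one class, the sum is h^2 + (N - h)^2 - N >= N^2 / 2 - N, and this is at least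
    N^2 / 6 for N >= 3. *)
Lemma sum_same_class N (beta : 'I_N -> bool) : (2 < N)%N ->
  N%:R ^+ 2 / 6 <= \sum_(a < N) \sum_(b < N) (a != b)%:R * (beta a == beta b)%:R :> R.
Proof.
move=> N3; pose x a : R := (beta a)%:R; pose h := \sum_(a < N) x a.
have -> : \sum_(a < N) \sum_(b < N) (a != b)%:R * (beta a == beta b)%:R =
   \sum_(a < N) \sum_(b < N) ((x a * x b + (1 - x a) * (1 - x b)) - (b == a)%:R) :> R.
  apply: eq_bigr => a _; apply: eq_bigr => b _; rewrite /x.
  have [->|nab] := eqVneq b a; first by case: (beta a) => /=; ring.
  by case: (beta a); case: (beta b) => /=; ring.
have -> : \sum_(a < N) \sum_(b < N) ((x a * x b + (1 - x a) * (1 - x b)) - (b == a)%:R) =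
   \sum_(a < N) (x a * h + (1 - x a) * (N%:R - h) - 1).
  apply: eq_bigr => a _; rewrite sumrB big_split /= -!mulr_sumr sumrB sumr_const card_ord -/h.
  congr (_ - _); rewrite (bigD1 a) //= eqxx big1 ?addr0 // => b /negPf->.
  by [].
rewrite sumrB big_split /= -!mulr_suml sumrB !sumr_const !card_ord -/h.
have : 3 <= N%:R :> R by rewrite ler_nat.
have : 0 <= (N%:R - 2 * h) ^+ 2 by rewrite sqr_ge0.
move: (N%:R : R) => M; nra.
Qed.

Lemma eo_same_top n x y : (0 < n)%N -> bit x n.-1 = bit y n.-1 ->
  flipprob (e_o R n) n / 2 <= ltprob n (e_o R n) x y.
Proof. by case: n => // n _ xy; apply: ltprob_same_top => // j; apply: flip_half_eo. Qed.

(** For N >= 3, [wkt] is at most 8 N^2 ln N / ln (4/3) for [e_a] and at least N 2^(n/6) / 96 for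
    [e_o]; 768 = 8 * 96. *)
Definition good_const : R := ln (4 / 3) / 768.

Lemma good_const_gt0 : 0 < good_const.
Proof. by rewrite divr_gt0 // ln43_gt0. Qed.

(** For N >= 3, at least N^2 / 6 ordered pairs agree on the top bit and at most N^2 / 12 are close,
    which leaves N^2 / 12 useful pairs. *)
Lemma good_of_few_close n N (C : {ffun 'I_N -> 'I_(2 ^ n)}) :
  (0 < n)%N -> (1 < N)%N -> injectiveb C ->
  (12 * nclose (width n) C < N ^ 2)%N -> good good_const C.
Proof.
move=> n0 N1 Cinj few.
have eo2 j : 0 < flipprob (e_o R n) j.+1 <= 2^-1 by apply: flip_half_eo.
have lnN : 0 < ln N%:R :> R by rewrite ln_gt0 // ltr1n.
have L0 : 0 < ln (4 / 3) :> R by apply: ln43_gt0.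
have N0 : 0 < N%:R :> R by rewrite ltr0n ltnW.
have wa0 : 0 < wkt n (e_a R) (arr_seq C) by apply: wkt_gt0 => // j; apply: flip_half_ea.
rewrite /good ler_pdivrMr ?mulr_gt0 // [leRHS]mulrAC ler_pdivlMr //.
have X0 : 0 <= powR 2 (n%:R / 6) :> R by rewrite powR_ge0.
have [N3|N2] := ltnP 2 N.
  have waL := wkt_ea_le R Cinj.
  set wa := wkt n (e_a R) _ in wa0 waL *; set wo := wkt n _ _.
  have Xqw := pow_sixth_le_flip_width R n n.
  set X := powR 2 (n%:R / 6) in X0 Xqw *.
  set q := flipprob _ _ in Xqw; set w : R := (width n)%:R in Xqw.
  have q0 : 0 < q by apply: powR_gt0.
  have w0 : 0 < w by rewrite ltr0n expn_gt0.
  (* Least contribution of a useful pair: distance w, direct comparison at the first level with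
     probability 1 / N, error q / 2. *)
  pose T : R := w * (N%:R^-1 * (q / 2)).
  have T0 : 0 <= T by rewrite ltW // !mulr_gt0 ?invr_gt0.
  pose same a b := bit (C a) n.-1 == bit (C b) n.-1.
  have wo_ge : (N%:R ^+ 2 / 12) * T <= 2 * wo.
    rewrite wkt_double //.
    have fewR : (nclose (width n) C)%:R <= N%:R ^+ 2 / 12 :> R.
      have : (12 * nclose (width n) C)%:R <= (N ^ 2)%:R :> R by rewrite ler_nat ltnW.
      by rewrite natrM natrX; lra.
    have S1 := sum_same_class (fun a => bit (C a) n.-1) N3.
    apply: (@le_trans _ _ ((\sum_(a < N) \sum_(b < N) (a != b)%:R * (same a b)%:R
       - (nclose (width n) C)%:R) * T)).
      by rewrite ler_wpM2r //; rewrite /same; lra.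
    rewrite natr_sum -sumrB mulr_suml; apply: ler_sum => a _.
    rewrite natr_sum -sumrB mulr_suml; apply: ler_sum => b _.
    have [->|nab] := eqVneq a b; first by rewrite /= !mul0r subr0 mul0r.
    rewrite /= !mul1r.
    have F0 : 0 <= `|(C a : nat)%:R - (C b : nat)%:R| * PrQ n (e_o R n) (arr_seq C) (C a) (C b).
      by rewrite mulr_ge0 // PrQ_ge0.
    case cl: (close _ _ _ _); first by apply: le_trans F0; case: (same a b) => /=; lra.
    case sm: (same a b); last by apply: le_trans F0; rewrite /=; lra.
    rewrite /= subr0 mul1r /T; apply: ler_pM => //.
    - by rewrite !mulr_ge0 ?invr_ge0 ?ltW.
    - by apply: far_dist; move: cl => /negbT; rewrite negb_or => /andP[].
    - have := PrQ_ge n eo2 (arr_uniq Cinj) (mem_arr C a) (mem_arr C b) (arr_neq Cinj nab).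
      apply: le_trans; rewrite size_arr ler_wpM2l ?invr_ge0 //.
      move/eqP: sm => sm; case: (leqP (C a) (C b)) => _; exact: eo_same_top.
  have : wo * (N%:R * ln N%:R) >= N%:R * X / 96 * (N%:R * ln N%:R).
    rewrite ler_wpM2r //; first by rewrite mulr_ge0 ?ltW.
    have TE : N%:R ^+ 2 / 12 * T = N%:R * (2 * q * w) / 48 by rewrite /T; field; rewrite gt_eqF.
    by have := ler_wpM2l (ltW N0) Xqw; lra.
  apply: le_trans.
  have c0 := good_const_gt0.
  apply: (le_trans (ler_wpM2l (mulr_ge0 (ltW c0) X0) waL)).
  rewrite le_eqVlt; apply/orP; left; apply/eqP; rewrite /good_const; field.
  by rewrite gt_eqF.
have {N2} N2 : N = 2%N by lia.
move: N2 C Cinj few wa0 lnN {N1 N0} => -> C Cinj few wa0 lnN.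
pose a0 : 'I_2 := ord0; pose b0 : 'I_2 := lift ord0 ord0.
have wE e : wkt n e (arr_seq C) =
    `|(C a0 : nat)%:R - (C b0 : nat)%:R| * PrQ n e (arr_seq C) (C a0) (C b0).
  rewrite wktE big_ord_recl big_ord1 (big_pred1 b0) ?big_pred0 ?addr0 //.
    by case=> [[|[|m]] lt].
  by case=> [[|[|m]] lt].
have nab := arr_neq Cinj (isT : a0 != b0).
have far : ~~ close n (width n) (C a0) (C b0).
  (* A single close pair already makes 12 * nclose exceed 2^2. *)
  apply: contraTN few => cl; rewrite -leqNgt /nclose (bigD1 a0) //= (bigD1 b0) //= cl; lia.
have := PrQ_pair_ratio (arr_uniq Cinj) (size_arr C) (mem_arr C a0) (mem_arr C b0) nab
  (ltn_ord _) (ltn_ord _) n0 far.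
rewrite !wE.
have : 0 <= `|(C a0 : nat)%:R - (C b0 : nat)%:R| :> R by [].
move: (`|_|) => d d0 h.
have := ler_wpM2l (mulr_ge0 (ltW good_const_gt0) d0) h.
rewrite (_ : good_const * d * (_ * _) = good_const * powR 2 (n%:R / 6) *
  (d * PrQ n (e_a R) (arr_seq C) (C a0) (C b0))); last by ring.
move/le_trans; apply; rewrite le_eqVlt; apply/orP; left; apply/eqP; rewrite /good_const; field.
by rewrite gt_eqF.
Qed.

End GoodArrays.

(** * Counting *)

Lemma near_iota w x y : near w x y -> y \in iota (x - w) (2 * w).
Proof. by rewrite /near mem_iota; lia. Qed.

(** Three windows of length 2w contain every close [y]: around [x], around its lower part, and
    around that part with the top bit set. *)
Lemma card_close n w (x : nat) : (0 < n)%N ->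
  (#|[pred y : 'I_(2 ^ n) | close n w x y]| <= 6 * w)%N.
Proof.
case: n => // n _; rewrite cardE -(size_map val).
pose l := (x %% 2 ^ n)%N.
pose s := (iota (x - w) (2 * w) ++ iota (l - w) (2 * w) ++
  iota (2 ^ n + l - w) (2 * w))%N.
have -> : (6 * w = size s)%N by rewrite !size_cat !size_iota; lia.
apply: uniq_leq_size; first by rewrite map_inj_uniq ?enum_uniq //; apply: val_inj.
move=> _ /mapP[y + ->]; rewrite mem_enum inE /close !mem_cat => /orP[/near_iota-> //|] /=.
have [yn|[z zn yE]] := pow2S_cases (ltn_ord y).
  by rewrite (modn_small yn) => /near_iota ->; rewrite orbT.
rewrite yE modnDl (modn_small zn) -/l /near => h.
by rewrite [X in _ || (_ || X)]mem_iota; apply/orP; right; apply/orP; right; lia.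
Qed.

Section Counting.
Variables (n N w : nat).
Hypothesis n0 : (0 < n)%N.
Let M := (2 ^ n)%N.
Let arr := {ffun 'I_N -> 'I_M}.

(** Transposing the values [C b] and [y] throughout the array keeps it injective even when [y] is
    already an entry. *)
Definition swap_entry (b : 'I_N) (Cy : arr * 'I_M) : arr * 'I_M :=
  ([ffun i => tperm (Cy.1 b) Cy.2 (Cy.1 i)], Cy.1 b).

Lemma swap_entryK b : involutive (swap_entry b).
Proof.
case=> C y; rewrite /swap_entry /= !ffunE tpermL; congr (_, _).
by apply/ffunP => i; rewrite !ffunE tpermC tpermK.
Qed.

(* [swap_entry b] is an involution of the pairs (injective array [C], value
   [y != C a]) that fixes [C a] and exchanges [C b] with [y]: given [C a], the
   entry [C b] is uniform among the other values. *)
Lemma sum_close_pair (a b : 'I_N) : a != b ->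
  (\sum_(C : arr | injectiveb C) close n w (C a) (C b) * M.-1 <=
   6 * w * #|[set C : arr | injectiveb C]|)%N.
Proof.
move=> nab.
pose P (Cy : arr * 'I_M) := injectiveb Cy.1 && (Cy.2 != Cy.1 a).
have PE Cy : P Cy -> P (swap_entry b Cy) /\ (swap_entry b Cy).1 a = Cy.1 a.
  case: Cy => C y /andP[/= Cinj yCa].
  have Cab : C b != C a.
    by apply: contra nab => /eqP/(injectiveP _ Cinj)->.
  have fixa : tperm (C b) y (C a) = C a by rewrite tpermD.
  split; last by rewrite /swap_entry /= ffunE.
  rewrite /P /swap_entry /= ffunE fixa Cab andbT.
  by apply/injectiveP => i j; rewrite !ffunE => /perm_inj; apply/injectiveP.
have -> : (\sum_(C : arr | injectiveb C) close n w (C a) (C b) * M.-1 =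
    \sum_(Cy | P Cy) close n w (Cy.1 a) (Cy.1 b))%N.
  rewrite -(pair_big_dep (fun C : arr => injectiveb C) (fun (C : arr) y => y != C a)
    (fun (C : arr) _ => close n w (C a) (C b) : nat)).
  apply: eq_bigr => C _; rewrite sum_nat_const cardC1 card_ord mulnC //.
have -> : (\sum_(Cy | P Cy) close n w (Cy.1 a) (Cy.1 b) =
    \sum_(Cy | P Cy) close n w (Cy.1 a) Cy.2)%N.
  rewrite (reindex_inj (inv_inj (swap_entryK b))); apply: eq_big => [Cy|Cy].
    by apply/idP/idP => /PE[] //; rewrite swap_entryK.
  by move/PE => []; rewrite swap_entryK => /PE[_ ->] _; rewrite /swap_entry /= ffunE tpermL.
rewrite -(pair_big_dep (fun C : arr => injectiveb C) (fun (C : arr) y => y != C a)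
  (fun (C : arr) y => close n w (C a) y : nat)).
rewrite [leqRHS]mulnC -sum_nat_const big_mkcond [leqRHS]big_mkcond.
apply: leq_sum => C _; rewrite inE; case: ifP => // _.
apply: leq_trans (card_close w (C a) n0).
rewrite -sum1_card [leqRHS]big_mkcond [leqLHS]big_mkcond; apply: leq_sum => y _ /=.
by rewrite inE; case: (y != _); case: close.
Qed.

End Counting.

(** Double counting of close ordered pairs: a bad array has at least N^2 / 12 of them, and
    [sum_close_pair] bounds the arrays in which a given pair is close; 72 = 12 * 6. *)
Lemma nbad_le (R : realType) n N : (0 < n)%N -> (1 < N)%N ->
  (nbad (good_const R) n N * (2 ^ n).-1 <=
   72 * width n * (ngood (good_const R) n N + nbad (good_const R) n N))%N.
Proof.
move=> n0 N1; set c := good_const R; set w := width n.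
have totE : (ngood c n N + nbad c n N =
    #|[set C : {ffun 'I_N -> 'I_(2 ^ n)} | injectiveb C]|)%N.
  rewrite -[RHS](cardsID [set C : {ffun 'I_N -> 'I_(2 ^ n)} | good c C]).
  by congr (_ + _)%N; apply: eq_card => C; rewrite !inE // andbC.
rewrite totE; set tot := #|_|.
have N2 : (0 < N ^ 2)%N by rewrite expn_gt0 ltnW.
rewrite -(leq_pmul2l N2).
apply: (@leq_trans (\sum_(C : {ffun 'I_N -> 'I_(2 ^ n)} | injectiveb C)
   12 * nclose w C * (2 ^ n).-1)).
  rewrite mulnA -big_distrl leq_mul2r; apply/orP; right.
  rewrite /nbad mulnC -sum_nat_const  [leqLHS]big_mkcond [leqRHS]big_mkcond.
  apply: leq_sum => C _; rewrite inE /=; case: (boolP (injectiveb C)) => //= Cinj.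
  case: ifP => // bad.
  by rewrite leqNgt; apply: contra bad; apply: good_of_few_close.
have -> : (\sum_(C : {ffun 'I_N -> 'I_(2 ^ n)} | injectiveb C) 12 * nclose w C * (2 ^ n).-1 =
   \sum_(a < N) \sum_(b < N) 12 * (\sum_(C : {ffun 'I_N -> 'I_(2 ^ n)} | injectiveb C)
      ((a != b) && close n w (C a) (C b)) * (2 ^ n).-1))%N.
  under eq_bigr => C _.
    rewrite /nclose -mulnA big_distrl big_distrr /=.
    under eq_bigr => a _ do rewrite big_distrl big_distrr /=.
    over.
  rewrite exchange_big /=; apply: eq_bigr => a _.
  by rewrite exchange_big /=; apply: eq_bigr => b _; rewrite -big_distrr.
have -> : (N ^ 2 * (72 * w * tot) = \sum_(a < N) \sum_(b < N) 12 * (6 * w * tot))%N.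
  by rewrite !sum_nat_const !card_ord; lia.
apply: leq_sum => a _; apply: leq_sum => b _; rewrite leq_mul2l /=.
have [->|nab] := eqVneq a b; first by rewrite big1.
exact: sum_close_pair.
Qed.

Theorem theorem7 (R : realType) :
  exists c : R, 0 < c /\
  exists K : R, 0 < K /\
  exists n0 : nat,
  forall n N : nat, (n0 <= n)%N -> (2 <= N)%N -> (N <= 2 ^ n)%N ->
    K * (powR 2 (n%:R / 3) / N%:R ^+ 2) * (nbad c n N)%:R <= (ngood c n N)%:R.
Proof.
exists (good_const R); split; first exact: good_const_gt0.
(* 576 = 2 * 288, where 288 = 72 * 4 comes from [nbad_le] and [wY]. The 2 pays for moving 288 B to
   the left: n >= 30 gives Y >= 1024 >= 2 * 288. *)
exists (576^-1); split; first by rewrite invr_gt0.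
exists 30%N => n N n30 N2 _.
have n0 : (0 < n)%N by apply: leq_trans n30.
have := nbad_le R n0 N2.
move: (nbad _ _ _) (ngood _ _ _) => B G BG.
set Y : R := powR 2 (n%:R / 3).
have Y1024 : 1024 <= Y.
  rewrite -[1024]/(1024%:R) -[1024%N]/(2 ^ 10)%N natrX -powR_mulrn // ler_powR ?ler1n //.
  have : 30 <= n%:R :> R by rewrite ler_nat.
  by lra.
have wY : (width n)%:R * Y <= 4 * (2 ^ n).-1%:R.
  apply: (@le_trans _ _ (2 * (2 ^ n)%:R)); last first.
    by rewrite -!natrM ler_nat; have := leq_pexp2l (isT : 0 < 2)%N n0; lia.
  rewrite widthE natrX -powR_mulrn // -{2}[2](@powRr1 R) // -!powR2D ler_powR ?ler1n //.
  by have := width_exp_le R n; lra.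
have M0 : 0 < (2 ^ n).-1%:R :> R.
  by rewrite ltr0n; have := leq_pexp2l (isT : 0 < 2)%N n0; lia.
have {}BG : B%:R * (2 ^ n).-1%:R <= 72 * (width n)%:R * (G%:R + B%:R) :> R.
  by rewrite -natrD -!natrM ler_nat.
have YB : Y * B%:R <= 288 * (G%:R + B%:R).
  rewrite -(ler_pM2r M0).
  have := ler_wpM2l (le_trans (ler0n R 1024) Y1024) BG.
  have := ler_wpM2r (addr_ge0 (ler0n R G) (ler0n R B)) wY.
  lra.
have B0 : 0 <= B%:R :> R by [].
have Ysq : Y / N%:R ^+ 2 <= Y.
  rewrite ler_pdivrMr ?exprn_gt0 ?ltr0n 1?ltnW // ler_peMr //; first by lra.
  by rewrite exprn_ege1 // ler1n ltnW.
have := ler_wpM2r B0 Ysq; have := ler_wpM2r B0 Y1024; lra.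
Qed.
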